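(* Fix integers $r \ge 1$, $k \ge 1$, and $b \ge 0$ such that $$r < \min\left( \binom{2k+2b+2}{2k-1},\ \binom{2k+2b}{2k-1} + \binom{2k+2b+1}{2k-1}\right).$$ Then $$\sum_{\pi} x^{|\pi|} = \sum \prod_{i=0}^b \binom{d_i + d_{i+1} + l_i - 1}{d_{i+1}+l_i} \binom{d_{i+1}+l_i}{l_i} \cdot \frac{\left(U_{k-1}\left(\frac{1-x}{2x}\right)\right)^{d_0-1}}{\left(U_k\left(\frac{1-x}{2x}\right)\right)^{d_0+1}}\, x^{-1-d_0+\sum_{j=0}^b (2 d_j + l_j)}.$$ Here the sum on the left is over all involutions $\pi\in I(3412)$ which contain exactly $r$ subsequences of type $2k\ldots 21$ (that is, exactly $r$ decreasing subsequences of length $2k$). The sum on the right is over all sequences $d_0, \ldots, d_b$ and $l_0, \ldots, l_b$ of nonnegative integers such that $$r = \sum_{i=0}^b d_i \left( \binom{2k+2i-2}{2k-1} + \binom{2k+2i-1}{2k-1}\right) + \sum_{i=0}^b l_i \binom{2k+2i}{2k-1},$$ and $d_{b+1} = 0$.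
   Context: $I(3412)$ denotes the set of all involutions (of all lengths $n\ge 0$, including the empty permutation), in one-line notation, which avoid $3412$, i.e. have no subsequence in the same relative order as $3412$. $|\pi|$ is the length of $\pi$. $U_n(x)$ is the $n$th Chebyshev polynomial of the second kind: $U_{-1}(x)=0$ and $U_n(\cos t) = \frac{\sin((n+1)t)}{\sin t}$ for $n \ge 0$. Binomial conventions: $\binom{a}{0}=1$ and $\binom{a}{-1}=0$ for any integer $a$, and $\binom{a}{m}=0$ for integers $0 \le a < m$. *)

(* Defs.v *)
From mathcomp Require Import all_boot all_order all_fingroup all_algebra.
From mathcomp Require Import boolp classical_sets reals trigo.
From mathcomp Require Import ring lra zify.

Set Implicit Arguments.
Unset Strict Implicit.
Unset Printing Implicit Defensive.

Import Order.TTheory GRing.Theory Num.Theory.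

Local Open Scope ring_scope.

(* The sequence t gives a pattern in one-line notation; an occurrence of it in
   s is recorded by its strictly increasing positions f. *)
Definition occurrences (t : seq nat) n (s : 'S_n) :
    {set {ffun 'I_(size t) -> 'I_n}} :=
  [set f : {ffun 'I_(size t) -> 'I_n} |
    [forall i : 'I_(size t), forall j : 'I_(size t),
      (i < j)%N ==> (f i < f j)%N] &&
    [forall i : 'I_(size t), forall j : 'I_(size t),
      (s (f i) < s (f j))%N == (nth 0%N t i < nth 0%N t j)%N]].

Definition avoids (t : seq nat) n (s : 'S_n) : bool := #|occurrences t s| == 0%N.

(* m ... 2 1 *)
Definition decreasing_pattern (m : nat) : seq nat := rev (iota 1 m).

Definition I3412 n : {set 'S_n} :=
  [set s : 'S_n | (s * s == 1)%g & avoids [:: 3; 4; 1; 2]%N s].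

(* The polynomial U_n with U_n(cos t) = sin ((n + 1) t) / sin t; it exists and
   is unique by chebyshevU_spec and chebyshevU_unique below. *)
Definition is_chebyshevU (R : realType) (n : nat) (p : {poly R}) : Prop :=
  forall t : R, sin t != 0 -> p.[cos t] = sin (n.+1%:R * t) / sin t.

Definition chebyshevU (R : realType) (n : nat) : {poly R} :=
  xget 0 [set p : {poly R} | is_chebyshevU n p]%classic.

Lemma chebyshevU_spec (R : realType) n : is_chebyshevU n (chebyshevU R n).
Proof.
apply: (@xgetPex _ 0 [set p : {poly R} | is_chebyshevU n p]%classic) => /=.
suff [p [q [hp _]]] : exists p q : {poly R},
    is_chebyshevU n p /\ is_chebyshevU n.+1 q by exists p.
elim: n => [|n [p [q [hp hq]]]].
  exists 1, ('X *+ 2); split=> t st; first by rewrite hornerE mul1r divff.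
  rewrite hornerMn hornerX (_ : 2%:R * t = t + t); last by ring.
  by rewrite sinD; field.
exists q, ('X *+ 2 * q - p); split=> // t st.
rewrite hornerD hornerN hornerM hornerMn hornerX hp// hq//.
have -> : n.+3%:R * t = n.+2%:R * t + t :> R by rewrite -(natr1 n.+2); ring.
have -> : n.+1%:R * t = n.+2%:R * t - t :> R by rewrite -(natr1 n.+1); ring.
by rewrite sinB sinD; field.
Qed.

Lemma chebyshevU_unique (R : realType) n (p : {poly R}) :
  is_chebyshevU n p -> p = chebyshevU R n.
Proof.
move=> hp; apply/eqP; rewrite -subr_eq0; set q := p - _.
pose t i : R := i.+1%:R^-1.
have t0 i : 0 < t i by rewrite invr_gt0.
have tpi i : t i < pi.
  by apply: (@le_lt_trans _ _ 1); [rewrite invf_le1// ler1n|have := pi_ge2 R; lra].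
apply/eqP/(@roots_geq_poly_eq0 _ _ [seq cos (t i) | i <- iota 0 (size q)]).
- apply/allP => _ /mapP[i _ ->]; have st : sin (t i) != 0.
    by rewrite gt_eqF// sin_gt0_pi// t0 tpi.
  by rewrite /root hornerD hornerN hp// (@chebyshevU_spec R n _ st) subrr.
- rewrite map_inj_uniq ?iota_uniq// => i j /cos_inj.
  rewrite !in_itv/= !(ltW (t0 _), ltW (tpi _)) => /(_ isT isT)/invr_inj/eqP.
  by rewrite eqr_nat => /eqP[].
- by rewrite size_map size_iota.
Qed.

(* The indeterminate x of the field of rational functions, and p(z) for a
   polynomial p and a rational function z. *)
Definition fracX (F : fieldType) : {fraction {poly F}} := tofrac 'X.

Definition evalfrac (F : fieldType) (p : {poly F}) (z : {fraction {poly F}}) :=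
  (map_poly (@tofrac {poly F} \o polyC) p).[z].

(* The formal power series \sum_n a_n x^n is the expansion at 0 of the
   rational function z. *)
Definition is_expansion (F : fieldType) (a : nat -> F)
    (z : {fraction {poly F}}) : Prop :=
  exists p q : {poly F},
    [/\ q`_0 != 0, z = tofrac p / tofrac q &
        forall n, \sum_(i < n.+1) q`_i * a (n - i)%N = p`_n].

(* The summation condition, for d, l : nat -> nat restricted to {0, ..., b}. *)
Definition pattern_weight (k b : nat) (d l : nat -> nat) : nat :=
  (\sum_(i < b.+1)
      d i * ('C(2 * k + 2 * i - 2, 2 * k - 1) + 'C(2 * k + 2 * i - 1, 2 * k - 1))
   + \sum_(i < b.+1) l i * 'C(2 * k + 2 * i, 2 * k - 1))%N.

(* For k > 0 the only subtraction truncated is in the first binomial, when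
   d_i = d_{i+1} = l_i = 0, where 'C(0, 0) = 1 agrees with the convention
   binom(-1, 0) = 1.  The value of d at b + 1 is used. *)
Definition chebyshev_term (R : realType) (k b : nat) (d l : nat -> nat) :
    {fraction {poly R}} :=
  let x := fracX R in
  let y := (1 - x) / (2%:R * x) in
  (\prod_(i < b.+1) ('C(d i + d i.+1 + l i - 1, d i.+1 + l i)
                     * 'C(d i.+1 + l i, l i)))%N%:R
  * (evalfrac (chebyshevU R (k - 1)) y ^ ((d 0%N)%:Z - 1)
     / evalfrac (chebyshevU R k) y ^+ (d 0%N + 1))
  * x ^ (- 1 - (d 0%N)%:Z + (\sum_(j < b.+1) (2 * d j + l j))%N%:Z).

(* A finite sequence d_0, ..., d_b extended by 0; in particular d_{b+1} = 0. *)
Definition extend0 (b m : nat) (d : {ffun 'I_b.+1 -> 'I_m}) (i : nat) : nat :=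
  if insub i is Some j then d j else 0%N.

(* The summation condition forces all d_i and l_i to be at most r, so that the
   sum over all sequences of natural numbers can be indexed by sequences with
   values in 'I_r.+1. *)
Lemma pattern_weight_bound (k b : nat) (d l : nat -> nat) (i : nat) :
  (0 < k)%N -> (i <= b)%N ->
  (d i <= pattern_weight k b d l)%N && (l i <= pattern_weight k b d l)%N.
Proof.
move=> k0 ib; have {ib} ib : (i < b.+1)%N by [].
have c1 : (0 < 'C(2 * k + 2 * i - 1, 2 * k - 1))%N by rewrite bin_gt0; lia.
have c2 : (0 < 'C(2 * k + 2 * i, 2 * k - 1))%N by rewrite bin_gt0; lia.
rewrite /pattern_weight (bigD1 (Ordinal ib))//= [X in (_ + X)%N](bigD1 (Ordinal ib))//=.
by apply/andP; split; nia.
Qed.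

(* Main.v *)
Require Import Defs.
From HB Require Import structures.
From mathcomp Require Import all_boot all_order all_fingroup all_algebra.
From mathcomp Require Import boolp classical_sets reals trigo.
From mathcomp Require Import ring_quotient ring zify.

(** An involution that avoids 3412 has no two crossing 2-cycles, so it is a
    noncrossing partial matching: it is empty, or it starts with a fixed point,
    or it starts with a cycle (1 m) that encloses an involution and is followed
    by another one.  These are the trees of type [motzkin], i.e. Motzkin paths:
    an arc is an up step with its matching down step, a point is a level step,
    and the height of either is the number of arcs around it.

    A decreasing subsequence lives in a single component, and enclosing a
    component in an arc multiplies the generating function of its decreasing
    subsequences (the empty one included) by (1 + z)^2.  Hence the number of
    decreasing subsequences of length 2k is additive: a point at height h
    contributes C(2h, 2k-1), and an arc starting at height h contributes
    C(2h, 2k-1) + C(2h+1, 2k-1) ([chains_word]).  Points below height k and arcs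
    below height k - 1 contribute nothing, and the bound on r forbids arcs at
    height k + b, so only 2b + 2 kinds of steps matter: d_i arcs at height
    k - 1 + i and l_i points at height k + i, for i <= b.

    With x marking length and q marking weight, the series A_h of the trees
    placed at height h satisfy
      A_h = 1 + x q^(la h) A_h + x^2 q^(mu h) A_(h+1) A_h.
    Below height k - 1 these are equations without q; they are solved by the
    polynomials f_j = x^j U_j((1-x)/(2x)), for which
    f_(j+1) = (1 - x) f_j - x^2 f_(j-1) (here [strip x j.+1] is f_j), and A_0 is
    a quotient of two expressions that are linear in t = x^2 q^(mu (k-1)) A_k.
    Cassini's identity f_(k-1)^2 - f_k f_(k-2) = x^(2k-2) turns its expansion
    in powers of t into the Chebyshev factor with d_0 = the exponent of t
    ([strip_resolution]).  From height k on, A_(k+i)^d_i is expanded as a negative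
    binomial series in x q^(la (k+i)) + x^2 q^(mu (k+i)) A_(k+i+1), which
    produces the binomial factors and the next power d_(i+1)
    ([expr_geometric_bivariate], [sum_transfer]).

    To keep all sums finite, the series computations take place in the ring of
    polynomials in x and q modulo x^(N+1) and q^(r+1), where q is nilpotent.
    Multiplying by f_k^(r+2) clears every denominator, and the coefficient of
    q^r is the expansion that has to be proved ([weight_gf_rational]). *)

Set Implicit Arguments.
Unset Strict Implicit.
Unset Printing Implicit Defensive.

Import Order.TTheory GRing.Theory Num.Theory.

Local Open Scope ring_scope.

(** * Motzkin trees *)

(** [Point t] is a fixed point followed by [t]; [Arc t u] is a 2-cycle around
    [t], followed by [u]. *)
Inductive motzkin := Leaf | Point of motzkin | Arc of motzkin & motzkin.

Lemma motzkin_comparable : comparable motzkin.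
Proof. by move=> t u; rewrite /decidable; decide equality. Qed.

HB.instance Definition _ := hasDecEq.Build motzkin (compareP motzkin_comparable).

Fixpoint msize t := match t with
  | Leaf => 0
  | Point t => (msize t).+1
  | Arc t u => (msize t + msize u).+2
  end%N.

(** The fuel [f] only makes the recursion structural: [trees_fuel f n] lists the
    trees of size [n] as soon as [n < f]. *)
Fixpoint trees_fuel f n : seq motzkin :=
  if f is f'.+1 then
    if n is n'.+1 then
      [seq Point t | t <- trees_fuel f' n'] ++
      [seq v | i <- iota 0 n',
               v <- [seq Arc t u | t <- trees_fuel f' i,
                                   u <- trees_fuel f' (n'.-1 - i)%N]]
    else [:: Leaf]
  else [::].

Lemma trees_fuelS f n : trees_fuel f.+1 n.+1 =
  [seq Point t | t <- trees_fuel f n] ++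
  [seq v | i <- iota 0 n,
           v <- [seq Arc t u | t <- trees_fuel f i, u <- trees_fuel f (n.-1 - i)%N]].
Proof. by []. Qed.

Definition trees n := trees_fuel n.+1 n.

Lemma mem_trees_fuel f n t : (n < f)%N -> (t \in trees_fuel f n) = (msize t == n).
Proof.
elim: f n t => // f IH [|n] t nf; first by rewrite inE; apply/eqP/eqP; case: t.
rewrite trees_fuelS mem_cat; apply/orP/eqP => [[/mapP[u]|]|].
- by rewrite IH //; move=> /eqP un ->; rewrite /= un.
- move=> /allpairsPdep[i [v [+ + ->]]].
  rewrite mem_iota => ilt /allpairsP[[u w]/= [hu hw ->]] /=.
  by move: hu hw; rewrite !IH; [|lia|lia] => /eqP? /eqP?; lia.
- case: t => //= [t [tn]|t u [tu]]; [left|right].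
    by rewrite map_f// IH ?tn.
  apply/allpairsPdep; exists (msize t), (Arc t u); split=> //.
    by rewrite mem_iota; lia.
  by apply: allpairs_f; rewrite IH //; lia.
Qed.

Lemma mem_trees n t : (t \in trees n) = (msize t == n).
Proof. exact: mem_trees_fuel. Qed.

Lemma uniq_trees_fuel f n : (n < f)%N -> uniq (trees_fuel f n).
Proof.
elim: f n => // f IH [|n] nf //; rewrite trees_fuelS.
rewrite cat_uniq map_inj_uniq ?IH//; last by move=> ? ? [].
rewrite andTb; apply/andP; split.
  by apply/hasPn => t /allpairsPdep[i [v [_ /allpairsP[[u w] [_ _ ->]] ->]]]; apply/mapP => -[].
apply: allpairs_uniq_dep => [|i|]; first exact: iota_uniq.
  rewrite mem_iota => ilt; apply: allpairs_uniq; rewrite ?IH//; try lia.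
  by move=> [? ?] [? ?] _ _ /= [-> ->].
move=> [i v] [j w] /allpairsPdep[i' [v' [i'n hv [ei ev]]]]
  /allpairsPdep[j' [w' [j'n hw [ej ew]]]] /= vw.
subst; move: hv hw => /allpairsP[[t u]/= [+ _ ->]] /allpairsP[[t' u'] /= [+ _ +]].
move: i'n j'n; rewrite !mem_iota => ? ?.
by rewrite !mem_trees_fuel; [|lia|lia] => /eqP<- /eqP<- [-> ->].
Qed.

Lemma uniq_trees n : uniq (trees n).
Proof. exact: uniq_trees_fuel. Qed.

Lemma trees_fuelE f n : (n < f)%N -> perm_eq (trees_fuel f n) (trees n).
Proof.
move=> nf; apply: uniq_perm; rewrite ?uniq_trees ?uniq_trees_fuel// => t.
by rewrite mem_trees mem_trees_fuel.
Qed.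

(** Decomposition at the first letter; in an arc, the enclosed tree and the one
    that follows share the [n - 1] remaining letters. *)
Lemma sum_trees_succ (V : nmodType) (E : motzkin -> V) n :
  \sum_(t <- trees n.+1) E t =
  \sum_(t <- trees n) E (Point t) +
  \sum_(i < n) \sum_(t <- trees i) \sum_(u <- trees (n.-1 - i)%N) E (Arc t u).
Proof.
rewrite {1}/trees trees_fuelS big_cat big_map; congr (_ + _).
rewrite big_allpairs_dep (_ : iota 0 n = index_iota 0 n) ?big_mkord; last first.
  by rewrite /index_iota subn0.
apply: eq_bigr => i _; have ilt := ltn_ord i; rewrite big_allpairs_dep.
rewrite (perm_big _ (trees_fuelE _)); last lia.
by apply: eq_bigr => t _; rewrite (perm_big _ (trees_fuelE _)); last lia.
Qed.

(** * Counting decreasing subsequences of a list *)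

(** A chain through [x] continues among the later entries related to [x].  The
    chains are listed, and not only counted, so that they can be matched with
    other objects by comparing lists without repetition. *)
Fixpoint chain_list (T : Type) (r : rel T) m : seq T -> seq (seq T) :=
  if m is m'.+1 then
    fix extend xs :=
      if xs is x :: xs' then
        extend xs' ++ [seq x :: ys | ys <- chain_list r m' [seq y <- xs' | r x y]]
      else [::]
  else fun=> [:: [::]].

Definition chains (T : Type) (r : rel T) m xs := size (chain_list r m xs).

Lemma chain_listS (T : Type) (r : rel T) m x xs :
  chain_list r m.+1 (x :: xs) =
  chain_list r m.+1 xs ++ [seq x :: ys | ys <- chain_list r m [seq y <- xs | r x y]].
Proof. by []. Qed.

Lemma chainsS (T : Type) (r : rel T) m x xs :
  chains r m.+1 (x :: xs) = (chains r m.+1 xs + chains r m [seq y <- xs | r x y])%N.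
Proof. by rewrite /chains chain_listS size_cat size_map. Qed.

Lemma mem_chain_list (T : eqType) (r : rel T) m xs ys :
  (ys \in chain_list r m xs) = [&& size ys == m, subseq ys xs & pairwise r ys].
Proof.
elim: m xs ys => [|m IHm] xs ys.
  by rewrite inE; case: ys => // ; rewrite sub0seq.
elim: xs ys => [|x xs IHxs] ys.
  by case: ys => [|y ys] /=; rewrite ?andbF.
rewrite chain_listS mem_cat IHxs; case: ys => [|y ys].
  by apply/orP => -[//|/mapP[]].
rewrite /= eqSS; case: (eqVneq y x) => [->|yx].
  rewrite mem_map; last by move=> ? ? [].
  rewrite IHm subseq_filter; case: eqP => //= _.
  case: (boolP (all _ _)) => //=; rewrite ?andbF// => _.
  apply/orP/andP => [[/andP[/cons_subseq] |] |[]]; rewrite ?andbT//; last by right; apply/andP.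
  by move=> /andP[].
have /negPf-> : y :: ys \notin [seq x :: zs | zs <- chain_list r m [seq z <- xs | r x z]].
  by apply/mapP => -[zs _ [yx' _]]; rewrite yx' eqxx in yx.
by rewrite orbF.
Qed.

Lemma uniq_chain_list (T : eqType) (r : rel T) m xs :
  uniq xs -> uniq (chain_list r m xs).
Proof.
elim: m xs => // m IHm; elim=> // x xs IHxs /andP[xxs uxs].
rewrite chain_listS cat_uniq IHxs// map_inj_uniq; last by move=> ? ? [].
rewrite IHm ?filter_uniq// andbT; apply/hasPn => _ /mapP[zs _ ->].
change (x :: zs \notin chain_list r m.+1 xs).
rewrite mem_chain_list; apply/and3P => -[_ /mem_subseq/(_ x) + _].
by rewrite mem_head (negPf xxs) => /(_ isT).
Qed.

Lemma chains_map (T U : Type) (f : T -> U) (r : rel U) m xs :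
  chains r m (map f xs) = chains (relpre f r) m xs.
Proof.
elim: m xs => // m IHm; elim=> // x xs IHxs.
by rewrite map_cons !chainsS IHxs filter_map IHm.
Qed.

Lemma eq_chains (T : Type) (r r' : rel T) m xs :
  r =2 r' -> chains r m xs = chains r' m xs.
Proof.
move=> rr'; elim: m xs => // m IHm; elim=> // x xs IHxs.
by rewrite !chainsS IHxs IHm (eq_filter (rr' x)).
Qed.

Lemma chains_cons (T : eqType) (r : rel T) m x xs :
  all (r x) xs -> chains r m.+1 (x :: xs) = (chains r m.+1 xs + chains r m xs)%N.
Proof. by move=> /all_filterP rx; rewrite chainsS rx. Qed.

Lemma chains_rcons (T : eqType) (r : rel T) m x xs :
  all (r^~ x) xs ->
  chains r m.+1 (rcons xs x) = (chains r m.+1 xs + chains r m xs)%N.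
Proof.
elim: m xs => [|m IHm]; elim=> // y xs IHxs /andP[ryx rxs].
  by rewrite rcons_cons !chainsS IHxs// filter_rcons ryx /chains /= addnAC.
rewrite rcons_cons !chainsS IHxs// filter_rcons ryx IHm; first exact: addnACA.
by apply/allP => z; rewrite mem_filter => /andP[_ /(allP rxs)].
Qed.

(** With no relation across the two parts, a nonempty chain stays in one. *)
Lemma chains_cat (T : eqType) (r : rel T) m xs ys :
  {in xs & ys, forall x y, ~~ r x y} ->
  chains r m.+1 (xs ++ ys) = (chains r m.+1 xs + chains r m.+1 ys)%N.
Proof.
elim: xs => // x xs IHxs H.
rewrite cat_cons !chainsS IHxs; last by move=> u v hu; apply: H; rewrite inE hu orbT.
rewrite filter_cat [filter (r x) ys](_ : _ = [::]) ?cats0 1?addnAC//.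
apply/eqP; rewrite -(negbK (_ == _)) -has_filter; apply/hasPn => y.
by apply: H; rewrite mem_head.
Qed.

Lemma pairwise_tnthP (T : Type) (r : rel T) m (w : m.-tuple T) :
  reflect (forall i j : 'I_m, (i < j)%N -> r (tnth w i) (tnth w j)) (pairwise r w).
Proof.
case: m w => [|m] w.
  by rewrite tuple0; apply: (iffP idP) => // _ [].
apply: (iffP (pairwiseP (thead w))); rewrite size_tuple => H i j.
  by move=> ij; rewrite !(tnth_nth (thead w)); apply: H; rewrite ?inE.
rewrite !inE => im jm; move/(H (Ordinal im) (Ordinal jm)).
by rewrite !(tnth_nth (thead w)).
Qed.

Lemma subseq_enum_ord n (ys : seq 'I_n) :
  subseq ys (enum 'I_n) = pairwise (fun i j : 'I_n => i < j)%N ys.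
Proof.
have tr : transitive (fun i j : 'I_n => (i < j)%N) by move=> a b c; apply: ltn_trans.
have enum_sorted : sorted (fun i j : 'I_n => i < j)%N (enum 'I_n).
  by have := iota_ltn_sorted 0 n; rewrite -val_enum_ord sorted_map.
rewrite -sorted_pairwise//; apply/idP/idP => [yn|ys_sorted].
  by apply: subseq_sorted yn _.
have -> : ys = [seq i <- enum 'I_n | i \in ys].
  apply: (irr_sorted_eq tr) => //; first by move=> i; rewrite ltnn.
    by apply: sorted_filter.
  by move=> i; rewrite mem_filter mem_enum andbT.
exact: filter_subseq.
Qed.

(** An occurrence is the list of its positions, and the pattern m ... 1 asks that
    later positions have smaller values. *)
Lemma card_occurrences_decreasing m n (s : 'S_n) :
  #|occurrences (decreasing_pattern m) s| =
  chains gtn m [seq (s i : nat) | i <- enum 'I_n].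
Proof.
pose r (i j : 'I_n) := (s j < s i)%N.
rewrite chains_map cardE (eq_chains _ _ (_ : _ =2 r))//.
set t := decreasing_pattern m; have st : size t = m by rewrite size_rev size_iota.
have ltm (i : 'I_(size t)) : (i < m)%N.
  by apply: leq_trans (ltn_ord i) _; rewrite st.
have nt (i : 'I_(size t)) : nth 0%N t i = (m - i)%N.
  have im := ltm i.
  by rewrite nth_rev ?size_iota// nth_iota; lia.
rewrite -(size_map (fun f => val (tuple_of_finfun f))); apply/perm_size/uniq_perm.
- rewrite map_inj_uniq ?enum_uniq// => f g /val_inj.
  exact: (can_inj tuple_of_finfunK).
- by apply: uniq_chain_list; apply: enum_uniq.
move=> ys; rewrite mem_chain_list subseq_enum_ord.
apply/mapP/and3P => [[f +] ->|[/eqP sy py ry]].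
  rewrite mem_enum inE => /andP[/forallP inc /forallP ord].
  split; first (by rewrite size_tuple {1}st);
    apply/pairwise_tnthP => i j ij; rewrite !tnth_mktuple.
    by have /forallP/(_ j)/implyP/(_ ij) := inc i.
  rewrite /r; have /forallP/(_ i)/eqP -> := ord j; rewrite !nt.
  by have := ltm i; have := ltm j; lia.
have syt : size ys == size t by rewrite sy st.
pose w := Tuple syt; exists (finfun_of_tuple w); last by rewrite finfun_of_tupleK.
have {}py : pairwise (fun i j : 'I_n => i < j)%N w by [].
have {}ry : pairwise r w by [].
have wE a : finfun_of_tuple w a = tnth w a.
  by rewrite -[in RHS](finfun_of_tupleK w) tnth_mktuple.
rewrite mem_enum inE; apply/andP; split; apply/forallP => i; apply/forallP => j.
  by apply/implyP => ij; rewrite !wE; apply: (pairwise_tnthP _ _ py).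
rewrite !wE !nt; apply/eqP; have im := ltm i; have jm := ltm j.
case: (ltngtP i j) => [ij|ji|/val_inj->]; last by rewrite !ltnn.
- have /ltnW := pairwise_tnthP _ _ ry _ _ ij.
  by rewrite leqNgt => /negPf->; apply/esym/negP; lia.
- have := pairwise_tnthP _ _ ry _ _ ji; rewrite {1}/r => ->.
  by apply/esym; lia.
Qed.

(** * The involution of a tree *)

(** The one-line notation, with values counted from 0. *)
Fixpoint word t : seq nat := match t with
  | Leaf => [::]
  | Point t => 0 :: map succn (word t)
  | Arc t u => (msize t).+1 :: rcons (map succn (word t)) 0 ++ map (addn (msize t).+2) (word u)
  end%N.

Lemma size_word t : size (word t) = msize t.
Proof.
elim: t => //= [t|t iht u ihu]; first by rewrite size_map => ->.
by rewrite size_cat size_rcons !size_map iht ihu addSn.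
Qed.

(** The first letter tells the two constructors apart, and for an arc it also
    gives the length of the enclosed block. *)
Lemma word_inj : injective word.
Proof.
elim=> [|t IHt|t IHt u IHu] [|t'|t' u'] //= [].
  by move/(inj_map succn_inj)/IHt->.
move=> tt' /eqP; rewrite eqseq_cat; last by rewrite !size_rcons !size_map !size_word tt'.
rewrite eqseq_rcons tt' eqxx andbT => /andP[/eqP/(inj_map succn_inj)/IHt-> /eqP].
by move/(inj_map (@addnI _))/IHu->.
Qed.

Section WordEntries.
Variables t u : motzkin.
Local Notation m := (msize t).
Local Notation entry t i := (nth 0%N (word t) i).
Local Open Scope nat_scope.

Lemma entry_point i : i < m -> entry (Point t) i.+1 = (entry t i).+1.
Proof. by move=> im /=; rewrite (nth_map 0) ?size_word. Qed.

Lemma entry_arc_open : entry (Arc t u) 0 = m.+1. Proof. by []. Qed.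

Lemma entry_arc_in i : i < m -> entry (Arc t u) i.+1 = (entry t i).+1.
Proof.
move=> im /=; rewrite nth_cat size_rcons size_map size_word leqW//.
by rewrite nth_rcons size_map size_word im (nth_map 0) ?size_word.
Qed.

Lemma entry_arc_close : entry (Arc t u) m.+1 = 0.
Proof.
by rewrite /= nth_cat size_rcons size_map size_word ltnSn nth_rcons size_map size_word ltnn eqxx.
Qed.

Lemma entry_arc_out i : i < msize u -> entry (Arc t u) (m.+2 + i) = m.+2 + entry u i.
Proof.
move=> iu; rewrite addSn /= nth_cat size_rcons size_map size_word ltnNge leq_addr /=.
by rewrite addKn (nth_map 0) ?size_word.
Qed.

(** For case analysis on a position together with its entry. *)
Variant arc_entry_spec : nat -> nat -> Prop :=
  | ArcOpen : arc_entry_spec 0 m.+1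
  | ArcIn j of j < m : arc_entry_spec j.+1 (entry t j).+1
  | ArcClose : arc_entry_spec m.+1 0
  | ArcOut j of j < msize u : arc_entry_spec (m.+2 + j) (m.+2 + entry u j).

Lemma arc_entryP i : i < msize (Arc t u) -> arc_entry_spec i (entry (Arc t u) i).
Proof.
move=> /= il; case: i il => [|i] il; first exact: ArcOpen.
case: (ltngtP i m) => im; first by rewrite entry_arc_in//; apply: ArcIn.
- have iu : i.+1 - m.+2 < msize u by lia.
  by have := ArcOut iu; rewrite -entry_arc_out// subnKC.
- by rewrite im entry_arc_close; apply: ArcClose.
Qed.

End WordEntries.

Lemma entry_involution t i : (i < msize t)%N ->
  (nth 0 (word t) i < msize t)%N /\ nth 0%N (word t) (nth 0%N (word t) i) = i.
Proof.
elim: t i => // [t IHt|t IHt u IHu] i.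
  case: i => [|i] // it; have [lt ei] := IHt i it.
  by rewrite entry_point// entry_point// ei.
move=> /arc_entryP[|j jt||j ju].
- by rewrite entry_arc_close /=; split=> //; lia.
- have [lt ej] := IHt j jt; rewrite entry_arc_in// ej /=; split=> //; lia.
- by rewrite entry_arc_open.
- have [lt ej] := IHu j ju; rewrite entry_arc_out// ej /=; split=> //; lia.
Qed.

(** The pattern forces the entries at [c] and [d] below those at [a] and [b].
    As all entries after an arc exceed those of its block, the four positions lie
    on the same side; inside the block the endpoints of the arc are excluded,
    because their entries are the largest and the smallest. *)
Lemma word_avoids3412 t a b c d : (a < b)%N -> (b < c)%N -> (c < d)%N -> (d < msize t)%N ->
  (nth 0 (word t) c < nth 0 (word t) d)%N -> (nth 0 (word t) d < nth 0 (word t) a)%N ->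
  (nth 0 (word t) a < nth 0 (word t) b)%N -> False.
Proof.
elim: t a b c d => // [t IHt|t IHt u IHu] a b c d ab bc cd dt.
  case: b ab bc => [|b] //= ab bc; case: c bc cd => [|c] //= bc cd.
  case: d cd dt => [|d] //= cd dt.
  rewrite !(nth_map 0%N) ?size_word; try lia.
  case: a ab => [|a] //= ab; rewrite !(nth_map 0%N) ?size_word; try lia.
  exact: IHt.
have Ht j : (j < msize t)%N -> (nth 0 (word t) j < msize t)%N.
  by move=> /entry_involution[].
have Sa : arc_entry_spec t u a (nth 0 (word (Arc t u)) a) by apply: arc_entryP; lia.
have Sb : arc_entry_spec t u b (nth 0 (word (Arc t u)) b) by apply: arc_entryP; lia.
have Sc : arc_entry_spec t u c (nth 0 (word (Arc t u)) c) by apply: arc_entryP; lia.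
have Sd := arc_entryP dt.
move: (nth _ _ a) (nth _ _ b) (nth _ _ c) (nth _ _ d) Sa Sb Sc Sd => va vb vc vd Sa Sb Sc Sd.
destruct Sa as [|a ha| |a ha]; destruct Sb as [|b hb| |b hb]; try lia;
destruct Sc as [|c hc| |c hc]; try lia; destruct Sd as [|d hd| |d hd]; try lia;
try by [have := Ht a ha; lia | have := Ht b hb; lia].
- by rewrite !ltnS; apply: IHt.
- by rewrite !ltn_add2l; apply: IHu; rewrite -(ltn_add2l (msize t).+2).
Qed.

(** If [g 0 = m + 1] then no cycle crosses (0 m+1), so the positions strictly
    inside it are permuted among themselves, and so are those after it. *)
Lemma noncrossing_word n (g : nat -> nat) :
  (forall i, i < n -> g i < n)%N -> (forall i, i < n -> g (g i) = i)%N ->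
  (forall i j, i < j -> j < g i -> g i < g j -> g j < n -> False)%N ->
  exists t, word t = mkseq g n.
Proof.
elim/ltn_ind: n g => -[|n] IH g gn gg gx; first by exists Leaf.
case g0 : (g 0%N) => [|m].
  have gS i : (i < n -> g i.+1 = (g i.+1).-1.+1)%N.
    by case E: (g i.+1) => // ilt; have := gg i.+1 ilt; rewrite E g0.
  have [||||t wt] := IH n _ (fun i => (g i.+1).-1) => //.
  - by move=> i ilt; have := gn i.+1 ilt; have := gS i ilt; lia.
  - by move=> i ilt; rewrite -gS// gg.
  - move=> i j ij; have [jn|?] := ltnP j n; last by have := gn i.+1; lia.
    by have := gx i.+1 j.+1; have := gS i; have := gS j jn; lia.
  exists (Point t); rewrite /= wt /mkseq /= g0 (iotaDl 1 0) -!map_comp.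
  congr (_ :: _); apply/eq_in_map => i; rewrite mem_iota add0n => ilt /=.
  by rewrite -gS.
have mn : (m.+1 < n.+1)%N by rewrite -g0 gn.
have gm : g m.+1 = 0%N by rewrite -g0 gg.
have inj i j : (i < n.+1 -> j < n.+1 -> g i = g j -> i = j)%N.
  by move=> ilt jlt e; rewrite -(gg i ilt) e gg.
(* the positions 1, ..., m lie under the cycle (0 m+1) *)
have inner i : (i < m -> 0 < g i.+1 <= m)%N.
  move=> im; have := gx 0%N i.+1; have := gn i.+1; rewrite g0.
  have : g i.+1 <> 0%N by move=> e; have := inj i.+1 m.+1; lia.
  have : g i.+1 <> m.+1%N by move=> e; have := inj i.+1 0%N; lia.
  lia.
have outer i : (m.+1 < i < n.+1 -> m.+1 < g i)%N.
  move=> im; have : g i <> 0%N by move=> e; have := inj i m.+1; lia.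
  have : g i <> m.+1%N by move=> e; have := inj i 0%N; lia.
  move=> ? ?; have := inner (g i).-1; case gi: (g i) => [|j] /=; first lia.
  by have := gg i; rewrite gi; lia.
have [||||t wt] := IH m _ (fun i => (g i.+1).-1); first lia.
- by move=> i im; have := inner i im; lia.
- by move=> i im; have := inner i im => ?; rewrite prednK ?gg//; lia.
- move=> i j ij; have [jm|?] := ltnP j m; last by have := inner i; lia.
  by have := gx i.+1 j.+1; have := inner i; have := inner j jm; lia.
have [||||u wu] := IH (n - m.+1)%N _ (fun i => g (m.+2 + i) - m.+2)%N; first lia.
- by move=> i im; have := gn (m.+2 + i)%N; have := outer (m.+2 + i)%N; lia.
- move=> i im; have := outer (m.+2 + i)%N => ?; rewrite subnKC ?gg; lia.
- move=> i j ij; have [jm|?] := ltnP j (n - m.+1); last first.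
    by have := gn (m.+2 + i)%N; lia.
  have := outer (m.+2 + i)%N; have := outer (m.+2 + j)%N.
  by have := gx (m.+2 + i)%N (m.+2 + j)%N; lia.
have st : msize t = m by rewrite -size_word wt size_mkseq.
have su : msize u = (n - m.+1)%N by rewrite -size_word wu size_mkseq.
exists (Arc t u); apply: (@eq_from_nth _ 0%N).
  by rewrite size_word size_mkseq /= st su; lia.
move=> i; rewrite size_word => ilt.
have iln : (i < n.+1)%N by move: ilt; rewrite /= st su; lia.
rewrite nth_mkseq//; case: (arc_entryP ilt) iln; rewrite st.
- by [].
- by move=> j jm _; rewrite wt nth_mkseq//; have := inner j jm; lia.
- by [].
- move=> j; rewrite su => jm _; rewrite wu nth_mkseq//.
  by have := outer (m.+2 + j)%N; lia.
Qed.

Lemma avoids3412P n (s : 'S_n) :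
  reflect (forall a b c d : 'I_n, (a < b < c)%N -> (c < d)%N ->
             (s c < s d < s a)%N -> (s a < s b)%N -> False)
          (avoids [:: 3; 4; 1; 2]%N s).
Proof.
rewrite /avoids cards_eq0.
apply: (iffP eqP) => [occ0 a b c d /andP[ab bc] cd /andP[scd sda] sab|avoid].
  pose w : (size [:: 3; 4; 1; 2]%N).-tuple 'I_n := [tuple a; b; c; d].
  have wE i : finfun_of_tuple w i = tnth w i.
    by rewrite -[in RHS](finfun_of_tupleK w) tnth_mktuple.
  suff : finfun_of_tuple w \in occurrences [:: 3; 4; 1; 2]%N s by rewrite occ0 inE.
  rewrite inE; apply/andP; split; apply/forallP => i; apply/forallP => j;
    rewrite !wE !(tnth_nth a);
    case: i => [[|[|[|[|?]]]] ?] //; case: j => [[|[|[|[|?]]]] ?] //=; apply/eqP; lia.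
apply/setP => f; rewrite inE [RHS]inE; apply/negP => /andP[/forallP inc /forallP ord].
have o i : (i < 4)%N -> (i < size [:: 3; 4; 1; 2]%N)%N by [].
pose a := Ordinal (o 0%N isT); pose b := Ordinal (o 1%N isT).
pose c := Ordinal (o 2%N isT); pose d := Ordinal (o 3%N isT).
have lt (i j : 'I_(size [:: 3; 4; 1; 2]%N)) : (i < j)%N -> (f i < f j)%N.
  by move=> ij; have /forallP/(_ j)/implyP/(_ ij) := inc i.
have sf (i j : 'I_(size [:: 3; 4; 1; 2]%N)) :
    (s (f i) < s (f j))%N = (nth 0 [:: 3; 4; 1; 2] i < nth 0 [:: 3; 4; 1; 2] j)%N.
  by have /forallP/(_ j)/eqP := ord i.
by apply: (avoid (f a) (f b) (f c) (f d)); rewrite ?lt ?sf.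
Qed.

Definition one_line n (s : 'S_n) : seq nat := [seq (s i : nat) | i <- enum 'I_n].

Lemma size_one_line n (s : 'S_n) : size (one_line s) = n.
Proof. by rewrite size_map -cardE card_ord. Qed.

Lemma nth_one_line n (s : 'S_n) (i : 'I_n) : nth 0%N (one_line s) i = s i.
Proof. by rewrite (nth_map i) ?size_enum_ord// nth_ord_enum. Qed.

Lemma one_line_inj n : injective (@one_line n).
Proof. by move=> s s' ss'; apply/permP => i; apply/val_inj; rewrite /= -!nth_one_line ss'. Qed.

(** If [i < j < s i < s j], then the positions i, j, s i, s j carry the values
    s i, s j, i, j, an occurrence of 3412; so cycles do not cross. *)
Lemma word_of_involution n (s : 'S_n) : s \in I3412 n -> exists t, word t = one_line s.
Proof.
rewrite inE => /andP[/eqP ss /avoids3412P avoid].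
have sK i : s (s i) = i by rewrite -permM ss perm1.
pose g i := nth 0%N (one_line s) i.
have gE (i : 'I_n) : g i = s i by rewrite /g nth_one_line.
have [|||t wt] := @noncrossing_word n g.
- by move=> i il; rewrite (gE (Ordinal il)).
- by move=> i il; rewrite (gE (Ordinal il)) gE sK.
- move=> i j ij jg gij gj.
  have jl : (j < n)%N.
    by apply: ltn_trans jg (ltn_trans gij gj).
  have il : (i < n)%N by apply: ltn_trans ij jl.
  move: jg gij ij; rewrite (gE (Ordinal il)) (gE (Ordinal jl)) => jg gij ij.
  apply: (avoid (Ordinal il) (Ordinal jl) (s (Ordinal il)) (s (Ordinal jl))) => //=.
    by rewrite ij.
  by rewrite !sK /= ij.
exists t; rewrite wt; apply: (@eq_from_nth _ 0%N); first by rewrite size_mkseq size_one_line.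
by move=> i; rewrite size_mkseq => il; rewrite nth_mkseq.
Qed.

Lemma involution_of_word t : exists2 s, s \in I3412 (msize t) & one_line s = word t.
Proof.
pose g (i : 'I_(msize t)) : 'I_(msize t) := Ordinal (entry_involution (ltn_ord i)).1.
have gK : cancel g g by move=> i; apply/val_inj; rewrite /= (entry_involution (ltn_ord i)).2.
pose s := perm (can_inj gK).
have sE (i : 'I_(msize t)) : s i = nth 0%N (word t) i :> nat by rewrite permE.
exists s; last first.
  apply: (@eq_from_nth _ 0%N); first by rewrite size_one_line size_word.
  by move=> i; rewrite size_one_line => il; rewrite (nth_one_line s (Ordinal il)) sE.
rewrite inE; apply/andP; split.
  by apply/eqP/permP => i; rewrite permM perm1 !permE gK.
apply/avoids3412P => a b c d /andP[ab bc] cd; rewrite !sE => /andP[? ?] ?.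
exact: (word_avoids3412 ab bc cd (ltn_ord d)).
Qed.

Lemma card_I3412 n (P : pred (seq nat)) :
  #|[set s in I3412 n | P (one_line s)]| = count (P \o word) (trees n).
Proof.
have words : perm_eq [seq one_line s | s <- enum (I3412 n)] [seq word t | t <- trees n].
  apply: uniq_perm.
  - by rewrite map_inj_uniq ?enum_uniq//; apply: one_line_inj.
  - by rewrite map_inj_uniq ?uniq_trees//; apply: word_inj.
  move=> w; apply/mapP/mapP => [[s]|[t]].
    rewrite mem_enum => /word_of_involution[t wt] ->; exists t => //.
    by rewrite mem_trees -size_word wt size_one_line.
  rewrite mem_trees => /eqP<- ->; have [s sI ws] := involution_of_word t.
  by exists s; rewrite ?mem_enum.
rewrite -count_map -(seq.permP words) count_map -size_filter cardE.
apply: perm_size; apply: uniq_perm => [||s]; first exact: enum_uniq.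
  by apply: filter_uniq; apply: enum_uniq.
by rewrite [RHS]mem_filter !mem_enum inE andbC.
Qed.

(** * The number of decreasing subsequences as a weight *)

Fixpoint weight p h t : nat := match t with
  | Leaf => 0
  | Point t => 'C(2 * h, p) + weight p h t
  | Arc t u => 'C(2 * h, p) + 'C(2 * h + 1, p) + weight p h.+1 t + weight p h u
  end%N.

(** The generating function of the decreasing subsequences of [word t] by
    length.  The empty one is counted in both components of a concatenation,
    hence the correction by 1; for a point it leaves (1 + 'X) - 1 = 'X. *)
Fixpoint chain_gf t : {poly int} := match t with
  | Leaf => 1
  | Point t => 'X + chain_gf t
  | Arc t u => (1 + 'X) ^+ 2 * chain_gf t + chain_gf u - 1
  end.

Definition counts_chains (p : {poly int}) xs := forall m, p`_m = (chains gtn m xs)%:Z.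

Lemma coef_mulDX (R : nzRingType) (p : {poly R}) m : ((1 + 'X) * p)`_m.+1 = p`_m.+1 + p`_m.
Proof. by rewrite mulrDl mul1r coefD coefXM. Qed.

Lemma coef0_mulDX (R : nzRingType) (p : {poly R}) : ((1 + 'X) * p)`_0 = p`_0.
Proof. by rewrite mulrDl mul1r coefD coefXM addr0. Qed.

Lemma counts_chains_cons p x xs : all (gtn x) xs ->
  counts_chains p xs -> counts_chains ((1 + 'X) * p) (x :: xs).
Proof.
move=> xxs pxs [|m]; first by rewrite coef0_mulDX pxs.
by rewrite coef_mulDX !pxs chains_cons// PoszD.
Qed.

Lemma counts_chains_rcons p x xs : all (ltn x) xs ->
  counts_chains p xs -> counts_chains ((1 + 'X) * p) (rcons xs x).
Proof.
move=> xxs pxs [|m]; first by rewrite coef0_mulDX pxs.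
by rewrite coef_mulDX !pxs chains_rcons// PoszD.
Qed.

Lemma counts_chains_cat p q xs ys : {in xs & ys, forall x y, x <= y}%N ->
  counts_chains p xs -> counts_chains q ys -> counts_chains (p + q - 1) (xs ++ ys).
Proof.
move=> xsys pxs qys [|m]; rewrite coefB coefD coef1 pxs qys //.
rewrite subr0 chains_cat ?PoszD// => x y xx yy.
by rewrite /= -leqNgt xsys.
Qed.

Lemma counts_chains_map p f xs : {mono f : x y / (x < y)%N} ->
  counts_chains p xs -> counts_chains p (map f xs).
Proof.
move=> fm pxs m; rewrite pxs chains_map; congr (Posz _); apply: eq_chains => x y /=.
by rewrite fm.
Qed.

Lemma word_lt t : all (fun x => x < msize t)%N (word t).
Proof.
apply/(all_nthP 0%N) => i; rewrite size_word => it.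
by have [] := entry_involution it.
Qed.

Lemma counts_chains_word t : counts_chains (chain_gf t) (word t).
Proof.
elim: t => [|t IHt|t IHt u IHu].
- by case=> [|m]; rewrite /= coef1.
- rewrite [X in counts_chains X](_ : _ = (1 + 'X) * 1 + chain_gf t - 1); last by rewrite /=; ring.
  apply: (@counts_chains_cat _ _ [:: 0%N]).
  + by move=> x y; rewrite inE => /eqP->.
  + by apply: counts_chains_cons => // -[|m]; rewrite coef1.
  + exact: counts_chains_map.
rewrite /= -cat_cons; apply: counts_chains_cat.
- move=> x y xw /mapP[z _ ->]; apply: leq_trans (leq_addr _ _).
  move: xw; rewrite inE mem_rcons inE.
  move=> /or3P[/eqP->|/eqP->|/mapP[i /(allP (word_lt t)) + ->]] //.
  by move=> ?; lia.
- rewrite expr2 -mulrA; apply: counts_chains_cons.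
    rewrite all_rcons /= all_map; apply: sub_all (word_lt t) => i /=; lia.
  apply: counts_chains_rcons; first by rewrite all_map; apply/allP.
  exact: counts_chains_map.
- by apply: counts_chains_map => // x y; rewrite ltn_add2l.
Qed.

Lemma coef_expDX n m : ((1 + 'X) ^+ n : {poly int})`_m = 'C(n, m)%:Z.
Proof.
by elim: n m => [|n IHn] [|m]; rewrite ?coef1 ?exprS ?coef0_mulDX ?coef_mulDX ?IHn ?bin0 ?binS //.
Qed.

(** [h] surrounding arcs multiply the generating function by (1 + z)^(2h); the
    subtraction of 1 leaves out the subsequences that use these arcs only. *)
Lemma weightE p h t :
  ((1 + 'X) ^+ (2 * h) * (chain_gf t - 1))`_p.+1 = (weight p h t)%:Z.
Proof.
elim: t h => [|t IHt|t IHt u IHu] h /=.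
- by rewrite subrr mulr0 coef0.
- rewrite -addrA mulrDr coefD IHt mulrC coefXM /= coef_expDX.
  by rewrite PoszD.
have -> : (1 + 'X) ^+ (2 * h) * ((1 + 'X) ^+ 2 * chain_gf t + chain_gf u - 1 - 1) =
  ((1 + 'X) ^+ (2 * h.+1) - (1 + 'X) ^+ (2 * h)) +
  (1 + 'X) ^+ (2 * h.+1) * (chain_gf t - 1) + (1 + 'X) ^+ (2 * h) * (chain_gf u - 1).
  by rewrite mulnS exprD; ring.
rewrite !coefD coefN IHt IHu !coef_expDX mulnS add2n !binS addn1 !PoszD.
ring.
Qed.

Lemma chains_word p t : chains gtn p.+1 (word t) = weight p 0 t.
Proof.
have := weightE p 0 t; rewrite mul1r coefB coef1 subr0 counts_chains_word.
by case.
Qed.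

Lemma card_involutions_weight m n r : (0 < m)%N ->
  #|[set s in I3412 n | #|occurrences (decreasing_pattern m) s| == r]| =
  count (fun t => weight m.-1 0 t == r) (trees n).
Proof.
case: m => // m _; rewrite (@eq_count _ _ ((fun w => chains gtn m.+1 w == r) \o word)).
  rewrite -card_I3412; apply: eq_card => s; rewrite !inE.
  by rewrite card_occurrences_decreasing.
by move=> t /=; rewrite chains_word.
Qed.

(** * Sums over finite sequences *)

Definition ffun_cons (X : finType) m (x : X) (g : {ffun 'I_m -> X}) : {ffun 'I_m.+1 -> X} :=
  [ffun i => oapp g x (unlift ord0 i)].

Lemma sum_ffun_cons (V : nmodType) (X : finType) m (E : {ffun 'I_m.+1 -> X} -> V) :
  \sum_f E f = \sum_x \sum_g E (ffun_cons x g).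
Proof.
rewrite pair_bigA /= (reindex (fun p => ffun_cons p.1 p.2)) //=.
exists (fun f => (f ord0, [ffun i => f (lift ord0 i)])) => [[x g] _ | f _] /=.
  by rewrite ffunE unlift_none; congr (_, _); apply/ffunP => i; rewrite !ffunE liftK.
by apply/ffunP => i; rewrite ffunE; case: unliftP => [j|] -> //=; rewrite ffunE.
Qed.

Lemma sum_ffun_ord1 (V : nmodType) (X : finType) (E : {ffun 'I_1 -> X} -> V) :
  \sum_f E f = \sum_x E [ffun=> x].
Proof.
rewrite (reindex (fun x : X => [ffun=> x])) //.
exists (fun f : {ffun 'I_1 -> X} => f ord0) => [x _|f _].
  by rewrite ffunE.
by apply/ffunP => i; rewrite ffunE (ord1 i); congr (f _); apply: val_inj.
Qed.

Lemma extend0_cons0 b m (x : 'I_m) (g : {ffun 'I_b.+1 -> 'I_m}) :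
  extend0 (ffun_cons x g) 0 = x.
Proof.
rewrite /extend0; case: insubP => //= i _ i0; rewrite ffunE.
by have -> : i = ord0 by [apply: val_inj]; rewrite unlift_none.
Qed.

Lemma extend0_consS b m (x : 'I_m) (g : {ffun 'I_b.+1 -> 'I_m}) i :
  extend0 (ffun_cons x g) i.+1 = extend0 g i.
Proof.
rewrite /extend0; case: insubP => [j jb ji|jb]; case: insubP => [j' jb' ji'|jb'] //=; try lia.
rewrite ffunE; have -> : j = lift ord0 j' by apply: val_inj; rewrite /= ji ji'.
by rewrite liftK.
Qed.

Lemma extend0_out b m (d : {ffun 'I_b.+1 -> 'I_m}) : extend0 d b.+1 = 0%N.
Proof. by rewrite /extend0 insubN// ltnn. Qed.

(** A transfer-matrix computation with the states d_0, ..., d_b: the value [P i j]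
    of state [j] at step [i] is replaced by its one-step expansion until step [b],
    where the chain stops in state 0, which is the value of [extend0 d] at
    [b + 1]. *)
Lemma sum_transfer (Q : comNzRingType) r b (W : nat -> nat -> nat -> nat -> Q)
    (P : nat -> nat -> Q) (H : nat -> Q) :
  (forall i j, (i < b)%N ->
     P i j = \sum_(l < r.+1) \sum_(j' < r.+1) W i j l j' * P i.+1 j') ->
  (forall j, P b j = \sum_(l < r.+1) W b j l 0%N) ->
  \sum_(j < r.+1) H j * P 0%N j =
  \sum_(d : {ffun 'I_b.+1 -> 'I_r.+1}) \sum_(l : {ffun 'I_b.+1 -> 'I_r.+1})
     H (extend0 d 0) * \prod_(i < b.+1) W i (extend0 d i) (extend0 l i) (extend0 d i.+1).
Proof.
elim: b W P H => [|b IHb] W P H Pstep Plast.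
  rewrite sum_ffun_ord1; apply: eq_bigr => j _; rewrite sum_ffun_ord1 Plast mulr_sumr.
  apply: eq_bigr => l _; rewrite big_ord1 extend0_out.
  have e (i : 'I_r.+1) : extend0 ([ffun=> i] : {ffun 'I_1 -> 'I_r.+1}) 0 = i.
    by rewrite /extend0; case: insubP => //= ? _ _; rewrite ffunE.
  by rewrite /= !e.
pose H' j' := \sum_(j < r.+1) \sum_(l < r.+1) H j * W 0%N j l j'.
transitivity (\sum_(j' < r.+1) H' j' * P 1%N j').
  under eq_bigr => j _ do rewrite Pstep// mulr_sumr.
  under [RHS]eq_bigr => j' _ do rewrite mulr_suml.
  rewrite [RHS]exchange_big; apply: eq_bigr => j _ /=.
  under [RHS]eq_bigr => j' _ do rewrite mulr_suml.
  rewrite [RHS]exchange_big; apply: eq_bigr => l _ /=.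
  by rewrite mulr_sumr; apply: eq_bigr => j' _; rewrite mulrA.
rewrite (IHb (fun i => W i.+1) (fun i => P i.+1) H'); last first.
- exact: Plast.
- by move=> i j ib; rewrite -Pstep.
rewrite [RHS]sum_ffun_cons [RHS]exchange_big; apply: eq_bigr => d _ /=.
under [RHS]eq_bigr => j _ do rewrite sum_ffun_cons exchange_big /=.
rewrite [RHS]exchange_big; apply: eq_bigr => l _ /=.
rewrite mulr_suml; apply: eq_bigr => j _; rewrite mulr_suml; apply: eq_bigr => l0 _.
rewrite [in RHS]big_ord_recl /= !extend0_cons0 extend0_consS -mulrA; congr (_ * (_ * _)).
by apply: eq_bigr => i _; rewrite /bump /= add1n !extend0_consS.
Qed.

Lemma sum_antidiagonal (V : nmodType) r (F : nat -> nat -> V) :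
  (forall l j, (r < l + j)%N -> F l j = 0) ->
  \sum_(l < r.+1) \sum_(j < r.+1) F l j = \sum_(m < r.+1) \sum_(j < m.+1) F (m - j)%N j.
Proof.
move=> F0; rewrite exchange_big.
transitivity (\sum_(j < r.+1) \sum_(m < r.+1 | (j <= m)%N) F (m - j)%N j); last first.
  rewrite (exchange_big_dep xpredT) //=; apply: eq_bigr => m _.
  by rewrite (big_ord_widen_cond r.+1 xpredT (fun j => F (m - j)%N j)) //; apply: ltn_ord.
apply: eq_bigr => j _; rewrite -(big_mkord (leq j) (fun m => F (m - j)%N j)).
have jr : (r.+1 - j <= r.+1)%N by apply: leq_subr.
rewrite (eq_bigl (fun m => xpredT m && (j <= m)%N))// -big_nat_widenl//.
rewrite [RHS](big_addn 0%N r.+1 j) -(big_mkord xpredT (F^~ j)).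
rewrite (big_cat_nat (leq0n _) jr)//= [X in _ + X]big_nat_cond [X in _ + X]big1 ?addr0.
  by apply: eq_bigr => l _; rewrite addnK.
by move=> l lr; apply: F0; lia.
Qed.

(** * Powers of the series above the strip *)

(** [A] is the inverse of [1 - c], so this is the negative binomial series, cut
    where the powers of [c] vanish; it is proved through Pascal's rule in the form
    (1 - c) G_(d+1) = G_d. *)
Lemma expr_negative_binomial (Q : comNzRingType) (A c : Q) r d :
  A * (1 - c) = 1 -> c ^+ r.+1 = 0 ->
  A ^+ d = \sum_(m < r.+1) 'C(d + m - 1, m)%:R * c ^+ m.
Proof.
move=> Ac c0; elim: d => [|d IHd].
  rewrite big_ord_recl !expr0 bin0 mulr1 big1 ?addr0// => m _.
  by rewrite bin_small ?mul0r // lift0; lia.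
rewrite exprS IHd; set G := \sum_(_ < _) _; set G' := RHS.
suff -> : G = (1 - c) * G' by rewrite mulrA Ac mul1r.
rewrite mulrBl mul1r /G /G' big_distrr /= [X in _ - X]big_ord_recr /=.
rewrite [X in _ * (_ * X) ]/= mulrCA -exprS c0 mulr0 addr0.
rewrite big_ord_recl [X in _ = X - _]big_ord_recl /= !bin0 !mulr1 -addrA; congr (_ + _).
rewrite -sumrB; apply: eq_bigr => i _.
rewrite mulrCA -exprS -mulrBl /bump /= add1n; congr (_ * _).
have -> : (d.+1 + i.+1 - 1 = (d + i).+1)%N by lia.
have -> : (d + i.+1 - 1 = d + i)%N by lia.
have -> : (d.+1 + i - 1 = d + i)%N by lia.
by rewrite binS natrD addrK.
Qed.

(** The negative binomial series in [u + v], with the powers of [u + v] expanded.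
    Combinatorially, [l] letters [u] and [j] letters [v] are distributed among [d]
    words. *)
Lemma expr_geometric_bivariate (Q : comNzRingType) (A u v : Q) r d :
  A * (1 - u - v) = 1 ->
  (forall l j, (r < l + j)%N -> u ^+ l * v ^+ j = 0) ->
  A ^+ d = \sum_(l < r.+1) \sum_(j < r.+1)
    ('C(d + j + l - 1, j + l) * 'C(j + l, l))%:R * u ^+ l * v ^+ j.
Proof.
move=> Auv uv0; rewrite (@sum_antidiagonal _ r (fun l j =>
  ('C(d + j + l - 1, j + l) * 'C(j + l, l))%:R * u ^+ l * v ^+ j)); last first.
  by move=> l j rlj; rewrite -mulrA uv0// mulr0.
rewrite (@expr_negative_binomial _ A (u + v) r); last first.
- rewrite exprDn big1// => i _; have ir := ltn_ord i.
  by rewrite uv0 ?mul0rn// subnK.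
- by rewrite opprD addrA.
apply: eq_bigr => m _; rewrite exprDn mulr_sumr; apply: eq_bigr => j _.
have jm : (j <= m)%N by rewrite -ltnS.
rewrite -[X in _ * X]mulr_natl -addnA subnKC// natrM bin_sub//.
by rewrite !mulrA.
Qed.

(** * The strip of small heights *)

(** [strip x n.+1] is x^n U_n((1-x)/(2x)), the determinant of 1 - x T for the
    transfer matrix T of the strip of [n] heights; the index is shifted so that
    [strip x 0 = 0] stands for U_(-1) = 0. *)
Fixpoint strip (R : nzRingType) (x : R) n : R :=
  if n is n'.+1 then
    if n' is n''.+1 then (1 - x) * strip x n' - x ^+ 2 * strip x n'' else 1
  else 0.

Lemma stripSS (R : nzRingType) (x : R) n :
  strip x n.+2 = (1 - x) * strip x n.+1 - x ^+ 2 * strip x n.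
Proof. by []. Qed.

Lemma rmorph_strip (R S : nzRingType) (f : {rmorphism R -> S}) x n :
  f (strip x n) = strip (f x) n.
Proof.
suff: f (strip x n) = strip (f x) n /\ f (strip x n.+1) = strip (f x) n.+1 by case.
elim: n => [|n [IHn IHSn]]; first by rewrite /= rmorph0 rmorph1.
split=> //; rewrite !stripSS.
by rewrite rmorphB (rmorphM f (1 - x)) (rmorphM f (x ^+ 2)) rmorphXn rmorphB rmorph1 IHn IHSn.
Qed.

Lemma strip_cassini (R : comNzRingType) (x : R) n :
  strip x n.+1 ^+ 2 = strip x n.+2 * strip x n + x ^+ (2 * n).
Proof.
elim: n => [|n IHn]; first by rewrite /= mulr0 muln0 expr1n add0r.
rewrite mulnS exprD (_ : x ^+ (2 * n) = strip x n.+1 ^+ 2 - strip x n.+2 * strip x n).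
  by rewrite !stripSS; ring.
by rewrite IHn addrC addKr.
Qed.

(** The coefficient of t^d in f_k^(r+2) A_0, for k = K + 1: the paths below
    height k with [d] marked excursions above height k - 1. *)
Definition strip_coef (R : nzRingType) (x : R) K r d :=
  if d is d'.+1 then x ^+ (2 * K) * strip x K.+2 ^+ (r - d') * strip x K.+1 ^+ d'
  else strip x K.+1 * strip x K.+2 ^+ r.+1.

(** With s_j = [strip x j], induction on j shows that
    A_(K-j) = (s_(j+1) - s_j t) / (s_(j+2) - s_(j+1) t).  For j = K the
    denominator is f - g t with f = s_(K+2) and g = s_(K+1); it divides
    f^(r+1) - (g t)^(r+1) = f^(r+1), and Cassini's identity simplifies the
    numerators. *)
Lemma strip_resolution (Q : comNzRingType) (x t : Q) (A : nat -> Q) K r :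
  (forall h, (h < K)%N -> A h * (1 - x - x ^+ 2 * A h.+1) = 1) ->
  A K * (1 - x - t) = 1 -> t ^+ r.+1 = 0 ->
  strip x K.+2 ^+ r.+2 * A 0%N = \sum_(d < r.+1) strip_coef x K r d * t ^+ d.
Proof.
move=> AS AK t0.
have resolve j : (j <= K)%N ->
    (strip x j.+2 - strip x j.+1 * t) * A (K - j)%N = strip x j.+1 - strip x j * t.
  elim: j => [|j IHj] jK; first by rewrite subn0 /= mul0r subr0 -[RHS]AK; ring.
  have e : (K - j = (K - j.+1).+1)%N by lia.
  have := IHj (ltnW jK); rewrite e => Aj.
  have -> : strip x j.+3 - strip x j.+2 * t =
      (strip x j.+2 - strip x j.+1 * t) * (1 - x - x ^+ 2 * A (K - j.+1).+1).
    rewrite mulrBr mulrCA Aj !stripSS; ring.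
  by rewrite -mulrA [_ * A (K - j.+1)%N]mulrC AS ?mulr1//; lia.
set f := strip x K.+2; set g := strip x K.+1.
(* (f - g t)^-1 times f^(r+1), as a geometric sum: t is nilpotent *)
pose G := \sum_(d < r.+1) f ^+ (r - d) * (g * t) ^+ d.
have fG : (f - g * t) * G = f ^+ r.+1.
  by rewrite /G -(subrXX f (g * t) r.+1) exprMn t0 mulr0 subr0.
have := resolve K (leqnn K); rewrite subnn -/f -/g => A0.
have -> : f ^+ r.+2 * A 0%N = g * f ^+ r.+1 + x ^+ (2 * K) * (t * G).
  rewrite exprSr -fG -[RHS](_ : G * (g * (f - g * t) + x ^+ (2 * K) * t) = _); last by ring.
  rewrite (_ : (f - g * t) * G * f * A 0%N = G * f * ((f - g * t) * A 0%N)); last by ring.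
  rewrite A0; have := strip_cassini x K; rewrite -/f -/g => c.
  rewrite (_ : g * (f - g * t) = g * f - g ^+ 2 * t); last by ring.
  by rewrite c; ring.
rewrite big_ord_recl expr0 mulr1; congr (_ + _).
have -> : t * G = t * \sum_(d < r) f ^+ (r - d) * (g * t) ^+ d.
  rewrite /G big_ord_recr /= mulrDr exprMn.
  rewrite [X in _ + X](_ : _ = f ^+ (r - r) * g ^+ r * t ^+ r.+1).
    by rewrite t0 mulr0 addr0.
  by rewrite exprS; ring.
rewrite !mulr_sumr; apply: eq_bigr => d _.
rewrite lift0 -[strip_coef _ _ _ _]/(x ^+ (2 * K) * f ^+ (r - d) * g ^+ d).
by rewrite exprMn [t ^+ _.+1]exprS; ring.
Qed.


(** * The weighted continued fraction *)

(** A continued fraction in which the first [K] levels carry no weight, while an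
    arc at height [K + i] has weight [mu (K + i)] and a point at height
    [K + 1 + i] has weight [la (K + 1 + i)].  The hypothesis on
    [mu (K.+1 + b)] makes q^(mu (K + 1 + b)) vanish, which ends the expansion at
    level [b] with d_(b+1) = 0. *)
Lemma weighted_continued_fraction (Q : comNzRingType) (x q : Q) (A : nat -> Q)
    (la mu : nat -> nat) K b r :
  (forall h, A h = 1 + x * q ^+ la h * A h + x ^+ 2 * q ^+ mu h * A h.+1 * A h) ->
  q ^+ r.+1 = 0 ->
  (forall h, h <= K -> la h = 0)%N -> (forall h, h < K -> mu h = 0)%N ->
  (forall h, K < h -> 0 < la h)%N -> (forall h, K <= h -> 0 < mu h)%N ->
  (r < mu (K.+1 + b))%N ->
  strip x K.+2 ^+ r.+2 * A 0%N =
  \sum_(d : {ffun 'I_b.+1 -> 'I_r.+1}) \sum_(l : {ffun 'I_b.+1 -> 'I_r.+1})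
    (\prod_(i < b.+1) ('C(extend0 d i + extend0 d i.+1 + extend0 l i - 1,
                          extend0 d i.+1 + extend0 l i)
                       * 'C(extend0 d i.+1 + extend0 l i, extend0 l i)))%:R
    * (strip_coef x K r (extend0 d 0)
       * x ^+ (\sum_(i < b.+1) (2 * extend0 d i + extend0 l i)))
    * q ^+ (\sum_(i < b.+1) extend0 d i * mu (K + i)%N
            + \sum_(i < b.+1) extend0 l i * la (K.+1 + i)%N).
Proof.
move=> AE q0 la0 mu0 la_gt0 mu_gt0 rmu.
have qr n : (r < n)%N -> q ^+ n = 0 by move=> rn; rewrite -(subnKC rn) exprD q0 mul0r.
have Ainv h : A h * (1 - x * q ^+ la h - x ^+ 2 * q ^+ mu h * A h.+1) = 1.
  rewrite (_ : A h * _ = A h - x * q ^+ la h * A h - x ^+ 2 * q ^+ mu h * A h.+1 * A h);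
    last by ring.
  by rewrite {1}AE; ring.
pose u i := x * q ^+ la (K.+1 + i)%N.
pose v i := x ^+ 2 * q ^+ mu (K + i)%N.
rewrite (@strip_resolution _ _ (v 0%N * A K.+1) _ _ r); last first.
- rewrite /v addn0 !exprMn -exprM qr ?mulr0 ?mul0r//.
  by have := mu_gt0 K (leqnn K); nia.
- by rewrite -[RHS](Ainv K) la0// expr0 mulr1 /v addn0.
- by move=> h hK; rewrite -[RHS](Ainv h) la0 ?mu0 ?expr0 ?mulr1//; apply: ltnW.
pose W i j l j' := ('C(j + j' + l - 1, j' + l) * 'C(j' + l, l))%:R * u i ^+ l * v i.+1 ^+ j'.
have vanish i l j : (r < l + j)%N -> u i ^+ l * (v i.+1 * A (K.+2 + i)%N) ^+ j = 0.
  move=> rlj; rewrite /u /v addnS -addSn.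
  have l0 : (0 < la (K.+1 + i))%N by apply: la_gt0; lia.
  have m0 : (0 < mu (K.+1 + i))%N by apply: mu_gt0; lia.
  move: (la _) (mu _) (A _) l0 m0 => a m B l0 m0.
  have -> : (x * q ^+ a) ^+ l * (x ^+ 2 * q ^+ m * B) ^+ j =
      x ^+ l * (x ^+ 2) ^+ j * B ^+ j * q ^+ (a * l + m * j).
    rewrite !exprMn -[(q ^+ a) ^+ l]exprM -[(q ^+ m) ^+ j]exprM exprD.
    by move: (x ^+ l) ((x ^+ 2) ^+ j) (q ^+ _) (q ^+ _) (B ^+ j) => *; ring.
  by rewrite qr ?mulr0//; nia.
have step i j : A (K.+1 + i)%N ^+ j =
    \sum_(l < r.+1) \sum_(j' < r.+1) W i j l j' * A (K.+1 + i.+1)%N ^+ j'.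
  rewrite (@expr_geometric_bivariate _ _ (u i) (v i.+1 * A (K.+2 + i)%N) r); last first.
  - exact: vanish.
  - by rewrite -[RHS](Ainv (K.+1 + i)%N) /u /v addnS.
  apply: eq_bigr => l _; apply: eq_bigr => j' _.
  by rewrite -(addSnnS K.+1 i) /W [(v _ * _) ^+ _]exprMn !mulrA.
have v0 : v b.+1 = 0 by rewrite /v addnS -addSn qr// mulr0.
(* the strip is left through level K + 1, where the transfer starts *)
transitivity (\sum_(d < r.+1) (strip_coef x K r d * v 0%N ^+ d) * A (K.+1 + 0)%N ^+ d).
  by apply: eq_bigr => d _; rewrite addn0 [(v _ * _) ^+ _]exprMn mulrA.
rewrite (@sum_transfer _ r b W (fun i j => A (K.+1 + i)%N ^+ j)
  (fun d => strip_coef x K r d * v 0%N ^+ d)); first last.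
- move=> j; rewrite step; apply: eq_bigr => l _.
  rewrite big_ord_recl big1 ?addr0 ?expr0 ?mulr1// => j' _.
  by rewrite /W v0 lift0 expr0n /= mulr0 mul0r.
- by move=> i j _; apply: step.
apply: eq_bigr => d _; apply: eq_bigr => l _.
have -> : \prod_(i < b.+1) W i (extend0 d i) (extend0 l i) (extend0 d i.+1) =
    (\prod_(i < b.+1) ('C(extend0 d i + extend0 d i.+1 + extend0 l i - 1,
                          extend0 d i.+1 + extend0 l i)
                       * 'C(extend0 d i.+1 + extend0 l i, extend0 l i)))%:R
    * \prod_(i < b.+1) u i ^+ extend0 l i * \prod_(i < b.+1) v i.+1 ^+ extend0 d i.+1.
  by rewrite natr_prod -!big_split.
(* d_(b+1) = 0, so the arcs counted by the W i and by v 0 are those of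
   d_0, ..., d_b *)
have vprod : v 0%N ^+ extend0 d 0 * \prod_(i < b.+1) v i.+1 ^+ extend0 d i.+1 =
    x ^+ (\sum_(i < b.+1) 2 * extend0 d i) * q ^+ (\sum_(i < b.+1) extend0 d i * mu (K + i)%N).
  transitivity (\prod_(i < b.+2) v i ^+ extend0 d i); first by rewrite [RHS]big_ord_recl.
  rewrite big_ord_recr /= extend0_out expr0 mulr1 -!prodrXr -big_split /=.
  by apply: eq_bigr => i _; rewrite /v exprMn -!exprM mulnC [(mu _ * _)%N]mulnC.
have -> : \prod_(i < b.+1) u i ^+ extend0 l i =
    x ^+ (\sum_(i < b.+1) extend0 l i) * q ^+ (\sum_(i < b.+1) extend0 l i * la (K.+1 + i)%N).
  rewrite -!prodrXr -big_split /=; apply: eq_bigr => i _.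
  by rewrite /u exprMn -exprM mulnC.
have -> : (\sum_(i < b.+1) (2 * extend0 d i + extend0 l i) =
    \sum_(i < b.+1) 2 * extend0 d i + \sum_(i < b.+1) extend0 l i)%N by rewrite big_split.
rewrite !exprD.
move: (_ ^+ extend0 d 0) (\prod_(i < b.+1) v i.+1 ^+ _) vprod => V0 V1 vprod.
move: (strip_coef _ _ _ _) (x ^+ \sum_(i < b.+1) extend0 l i) => s xl.
move: (q ^+ \sum_(i < b.+1) extend0 l i * _) (_%:R) => ql C.
rewrite (_ : s * V0 * _ = C * s * xl * ql * (V0 * V1)); last by ring.
rewrite vprod; ring.
Qed.

(** * Truncated generating functions *)

(** The quotient by the ideal generated by x^(N+1) and q^(r+1); the outer variable
    is x and the inner one is q. *)
Lemma truncation_quotient (F : fieldType) (N r : nat) :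
  exists (Q : comNzRingType) (f : {rmorphism {poly {poly F}} -> Q}),
  forall u v, f u = f v <->
    (forall n w, (n <= N)%N -> (w <= r)%N -> u`_n`_w = v`_n`_w).
Proof.
pose S : {pred {poly {poly F}}} :=
  [pred u : {poly {poly F}} | [forall n : 'I_N.+1, forall w : 'I_r.+1, u`_n`_w == 0]].
have SP (u : {poly {poly F}}) :
    reflect (forall n w, (n <= N)%N -> (w <= r)%N -> u`_n`_w = 0) (u \in S).
  apply: (iffP forallP) => [H n w nN wr|H n].
    by have /forallP/(_ (Ordinal (wr : w < r.+1)%N))/eqP := H (Ordinal (nN : n < N.+1)%N).
  by apply/forallP => w; rewrite H // -ltnS.
have Sideal : idealr_closed S.
  split.
  - by apply/SP => n w _ _; rewrite !coef0.
  - by apply/SP => /(_ 0%N 0%N isT isT)/eqP; rewrite !coef1 oner_eq0.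
  move=> a u v /SP uS /SP vS; apply/SP => n w nN wr.
  rewrite coefD coefD vS// addr0 coefM coef_sum big1// => i _.
  rewrite coefM big1// => j _; rewrite uS ?mulr0//.
    by apply: leq_trans nN; apply: leq_subr.
  by apply: leq_trans wr; apply: leq_subr.
pose I : idealr {poly {poly F}} := HB.pack S (isIdealr.Build _ _ Sideal).
exists {ideal_quot I}, \pi_{ideal_quot I}%qT => u v.
split=> [/eqP|uv].
  rewrite -Quotient.idealrBE => /SP uv n w nN wr; apply/eqP.
  by rewrite -subr_eq0 -!coefB uv.
apply/eqP; rewrite -Quotient.idealrBE; apply/SP => n w nN wr.
by rewrite !coefB uv// subrr.
Qed.

Lemma strip_coef0 (R : nzRingType) n : (strip ('X : {poly R}) n.+1)`_0 = 1.
Proof.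
elim: n => [|n IHn]; first by rewrite coef1.
by rewrite stripSS expr2 coefB !coef0M IHn coefB coef1 !coefX !mul0r !subr0 mulr1.
Qed.

Lemma rmorph_strip_coef (R S : nzRingType) (f : {rmorphism R -> S}) x K r d :
  f (strip_coef x K r d) = strip_coef (f x) K r d.
Proof. by case: d => [|d]; rewrite /strip_coef !rmorphM !rmorphXn !rmorph_strip. Qed.

Definition weight_gf (F : fieldType) p h n : {poly F} :=
  \sum_(t <- trees n) 'X^(weight p h t).

Lemma coef_weight_gf (F : fieldType) p h n r :
  (weight_gf F p h n)`_r = (count (fun t => weight p h t == r) (trees n))%:R.
Proof.
rewrite coef_sum -sum1_count natr_sum [RHS]big_mkcond; apply: eq_bigr => t _.
by rewrite coefXn eq_sym; case: eqP.
Qed.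

Lemma weight_gf0 (F : fieldType) p h : weight_gf F p h 0 = 1.
Proof. by rewrite /weight_gf big_seq1 expr0. Qed.

Lemma weight_gfS (F : fieldType) p h n :
  weight_gf F p h n.+1 = 'X^('C(2 * h, p)) * weight_gf F p h n +
  'X^('C(2 * h, p) + 'C(2 * h + 1, p)) *
    \sum_(i < n) weight_gf F p h.+1 i * weight_gf F p h (n.-1 - i).
Proof.
rewrite /weight_gf sum_trees_succ; congr (_ + _).
  by rewrite mulr_sumr; apply: eq_bigr => t _; rewrite -exprD.
rewrite mulr_sumr; apply: eq_bigr => i _.
rewrite mulr_suml mulr_sumr; apply: eq_bigr => t _.
rewrite !mulr_sumr; apply: eq_bigr => u _.
by rewrite -!exprD addnA.
Qed.

Lemma strip_polyC (F : fieldType) n :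
  strip ('X : {poly {poly F}}) n = map_poly polyC (strip 'X n).
Proof. by rewrite [RHS]rmorph_strip /= map_polyX. Qed.

(** The coefficient of x^N q^r in the continued fraction: multiplication by a
    polynomial in x alone acts on the coefficient of q^r, a series in x,
    by convolution. *)
Lemma weight_gf_rational (F : fieldType) K b r N :
  (r < 'C(2 * (K.+1 + b), 2 * K + 1) + 'C(2 * (K.+1 + b) + 1, 2 * K + 1))%N ->
  \sum_(i < N.+1) (strip ('X : {poly F}) K.+2 ^+ r.+2)`_i *
    (weight_gf F (2 * K + 1) 0 (N - i))`_r =
  (\sum_(d : {ffun 'I_b.+1 -> 'I_r.+1}) \sum_(l : {ffun 'I_b.+1 -> 'I_r.+1} |
      (r == \sum_(i < b.+1) extend0 d i *
              ('C(2 * (K + i), 2 * K + 1) + 'C(2 * (K + i) + 1, 2 * K + 1))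
           + \sum_(i < b.+1) extend0 l i * 'C(2 * (K.+1 + i), 2 * K + 1))%N)
    (\prod_(i < b.+1) ('C(extend0 d i + extend0 d i.+1 + extend0 l i - 1,
                          extend0 d i.+1 + extend0 l i)
                       * 'C(extend0 d i.+1 + extend0 l i, extend0 l i)))%:R
    * (strip_coef 'X K r (extend0 d 0)
       * 'X^(\sum_(i < b.+1) (2 * extend0 d i + extend0 l i))))`_N.
Proof.
set p := (2 * K + 1)%N => rmu.
have [Q [f fE]] := truncation_quotient F N r.
(* no coefficient of x^n with n <= N sees the truncation *)
pose A h : {poly {poly F}} := \poly_(n < N.+1) weight_gf F p h n.
pose la h := 'C(2 * h, p); pose mu h := ('C(2 * h, p) + 'C(2 * h + 1, p))%N.
have AE h : f (A h) = 1 + f 'X * f 'X%:P ^+ la h * f (A h) +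
    f 'X ^+ 2 * f 'X%:P ^+ mu h * f (A h.+1) * f (A h).
  rewrite -!rmorphXn -!rmorphM -(rmorph1 f) -!rmorphD; apply/fE => n w nN _.
  apply: (congr1 (fun u : {poly F} => u`_w)); rewrite expr2 /= -!mulrA !coefD coef1 !coefXM.
  case: n nN => [|[|n]] nN; rewrite /= ?coefCM.
  - by rewrite !addr0 /A coef_poly weight_gf0.
  - rewrite add0r addr0 /A !coef_poly !ltnS nN weight_gfS big_ord0 mulr0 addr0.
    by [].
  - rewrite /A coefM !coef_poly !ltnS nN (ltnW nN) add0r.
    rewrite weight_gfS; congr (_ + _ * _); apply: eq_bigr => i _.
    have ? := ltn_ord i; rewrite !coef_poly.
    by rewrite !ifT//; lia.
have q0 : f 'X%:P ^+ r.+1 = 0.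
  rewrite -rmorphXn -(rmorph0 f); apply/fE => n w _ wr.
  rewrite !coef0 -polyC_exp coefC; case: n => [|n]; rewrite ?coef0//= coefXn.
  by case: eqP => // wE; rewrite wE ltnn in wr.
have E : f (strip 'X K.+2 ^+ r.+2 * A 0%N) =
  f (\sum_(d : {ffun 'I_b.+1 -> 'I_r.+1}) \sum_(l : {ffun 'I_b.+1 -> 'I_r.+1})
      (\prod_(i < b.+1) ('C(extend0 d i + extend0 d i.+1 + extend0 l i - 1,
                            extend0 d i.+1 + extend0 l i)
                         * 'C(extend0 d i.+1 + extend0 l i, extend0 l i)))%:R
      * (strip_coef 'X K r (extend0 d 0)
         * 'X^(\sum_(i < b.+1) (2 * extend0 d i + extend0 l i)))
      * ('X%:P) ^+ (\sum_(i < b.+1) extend0 d i * mu (K + i)%N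
              + \sum_(i < b.+1) extend0 l i * la (K.+1 + i)%N)).
  rewrite rmorphM rmorphXn rmorph_strip.
  rewrite (@weighted_continued_fraction Q (f 'X) (f 'X%:P) (f \o A) la mu K b r AE q0)//.
  - rewrite rmorph_sum; apply: eq_bigr => d _; rewrite rmorph_sum; apply: eq_bigr => l _.
    by rewrite !(rmorphM f) rmorph_nat rmorph_strip_coef !(rmorphXn f).
  - by move=> h hK; rewrite /la bin_small// /p; lia.
  - by move=> h hK; rewrite /mu !bin_small// /p; lia.
  - by move=> h hK; rewrite /la bin_gt0 /p; lia.
  - by move=> h hK; rewrite /mu addn_gt0 !bin_gt0 /p; lia.
have {E} := (fE _ _).1 E N r (leqnn N) (leqnn r).
rewrite strip_polyC -rmorphXn coefM coef_sum => E.
transitivity (\sum_(i < N.+1)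
    ((map_poly polyC (strip 'X K.+2 ^+ r.+2))`_i * (A 0%N)`_(N - i))`_r).
  by apply: eq_bigr => i _; rewrite coef_map coefCM coef_poly ltnS leq_subr.
rewrite E !coef_sum; apply: eq_bigr => d _; rewrite !coef_sum [RHS]big_mkcond.
apply: eq_bigr => l _.
rewrite -(map_polyX polyC) -rmorph_strip_coef -rmorphXn -rmorphM.
rewrite -(rmorph_nat (map_poly (@polyC F) : {rmorphism _ -> _})) -rmorphM.
rewrite -polyC_exp coefMC coef_map coefCM coefXn /=.
by case: eqP; rewrite ?mulr1 ?mulr0.
Qed.

(** * Chebyshev polynomials *)

Lemma chebyshevU0 (R : realType) : chebyshevU R 0 = 1.
Proof. by apply/esym/chebyshevU_unique => t st; rewrite hornerE mul1r divff. Qed.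

Lemma chebyshevU1 (R : realType) : chebyshevU R 1 = 'X *+ 2.
Proof.
apply/esym/chebyshevU_unique => t st.
rewrite hornerMn hornerX (_ : 2%:R * t = t + t); last by ring.
by rewrite sinD; field.
Qed.

Lemma chebyshevUSS (R : realType) n :
  chebyshevU R n.+2 = 'X *+ 2 * chebyshevU R n.+1 - chebyshevU R n.
Proof.
apply/esym/chebyshevU_unique => t st.
rewrite hornerD hornerN hornerM hornerMn hornerX !chebyshevU_spec//.
have -> : n.+3%:R * t = n.+2%:R * t + t :> R by rewrite -(natr1 n.+2); ring.
have -> : n.+1%:R * t = n.+2%:R * t - t :> R by rewrite -(natr1 n.+1); ring.
by rewrite sinB sinD; field.
Qed.

Section Evalfrac.
Variables (F : fieldType) (z : {fraction {poly F}}).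

Lemma evalfracB p q : evalfrac (p - q) z = evalfrac p z - evalfrac q z.
Proof. by rewrite /evalfrac rmorphB hornerD hornerN. Qed.

Lemma evalfracM p q : evalfrac (p * q) z = evalfrac p z * evalfrac q z.
Proof. by rewrite /evalfrac rmorphM hornerM. Qed.

Lemma evalfrac1 : evalfrac 1 z = 1.
Proof. by rewrite /evalfrac rmorph1 hornerC. Qed.

Lemma evalfracX2 : evalfrac ('X *+ 2) z = z *+ 2.
Proof. by rewrite /evalfrac rmorphMn /= map_polyX hornerMn hornerX. Qed.

End Evalfrac.

Lemma fracX_neq0 (F : fieldType) : fracX F != 0.
Proof. by rewrite /fracX tofrac_eq0 polyX_eq0. Qed.

(** Multiplication by x^n turns the recurrence of U_n(y) into that of [strip],
    because 2 x y = 1 - x. *)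
Lemma strip_of_recurrence (F : fieldType) (x : F) (e : nat -> F) :
  x != 0 -> 2%:R != 0 :> F ->
  let y := (1 - x) / (2%:R * x) in
  e 0%N = 1 -> e 1%N = y *+ 2 -> (forall n, e n.+2 = y *+ 2 * e n.+1 - e n) ->
  forall n, e n = strip x n.+1 / x ^+ n.
Proof.
move=> x0 two0 y e0 e1 eS n.
have y2 : y *+ 2 = (1 - x) / x by rewrite /y -mulr_natl; field; rewrite x0 two0.
suff : e n = strip x n.+1 / x ^+ n /\ e n.+1 = strip x n.+2 / x ^+ n.+1 by case.
elim: n => [|n [IHn IHSn]].
  rewrite e0 e1 y2 stripSS /=.
  by rewrite expr0 expr1 mulr1 mulr0 subr0 divr1.
split=> //; rewrite eS IHn IHSn y2 (stripSS _ n.+1) !exprS.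
have := expf_neq0 n x0; move: (x ^+ n) (strip _ _) (strip _ _) => a s s' a0.
by field; rewrite x0 a0.
Qed.

Lemma evalfrac_chebyshev (R : realType) n : let x := fracX R in
  evalfrac (chebyshevU R n) ((1 - x) / (2%:R * x)) = tofrac (strip 'X n.+1) / x ^+ n.
Proof.
move=> x; rewrite rmorph_strip.
apply: (@strip_of_recurrence _ x (fun n => evalfrac (chebyshevU R n) _)).
- exact: fracX_neq0.
- by rewrite -(rmorph_nat (@tofrac {poly R})) tofrac_eq0 -polyC_natr polyC_eq0 pnatr_eq0.
- by rewrite chebyshevU0 evalfrac1.
- by rewrite chebyshevU1 evalfracX2.
- by move=> m; rewrite chebyshevUSS evalfracB evalfracM evalfracX2.
Qed.

(** A factor C(m - 1, m) with m = d_(i+1) + l_i vanishes unless m = 0: without arcs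
    at one level there is nothing above it. *)
Lemma pattern_weight_no_arc k b (d l : nat -> nat) : d 0%N = 0%N ->
  (\prod_(i < b.+1) ('C(d i + d i.+1 + l i - 1, d i.+1 + l i)
                     * 'C(d i.+1 + l i, l i)) != 0)%N ->
  pattern_weight k b d l = 0%N.
Proof.
move=> d0 prod0; have factor i : (i <= b)%N -> d i = 0%N -> d i.+1 = 0%N /\ l i = 0%N.
  move=> ib di; suff : (d i.+1 + l i = 0)%N by lia.
  apply/eqP; apply: contraNT prod0 => m0; rewrite (bigD1 (Ordinal (ib : i < b.+1)%N)) //= di.
  by rewrite bin_small ?mul0n//; lia.
have di i : (i <= b)%N -> d i = 0%N.
  by elim: i => // i IHi ib; have [] := factor i (ltnW ib) (IHi (ltnW ib)).
rewrite /pattern_weight big1 => [|i _]; last by rewrite di ?mul0n// -ltnS.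
rewrite big1 // => i _; have ib : (i <= b)%N by rewrite -ltnS.
by have [_ ->] := factor i ib (di i ib).
Qed.

Lemma exprz_subn (F : fieldType) (x : F) (e n : nat) :
  x != 0 -> x ^ (e%:Z - n%:Z) = x ^+ e / x ^+ n.
Proof. by move=> x0; rewrite expfzDr// -exprnN. Qed.

Lemma strip_term_ratio (F : fieldType) (x f g c : F) (K n r e : nat) :
  x != 0 -> f != 0 -> (n <= r)%N ->
  c * ((g / x ^+ K) ^+ n / (f / x ^+ K.+1) ^+ n.+2) * (x ^+ e / x ^+ n.+2) =
  c * (x ^+ (2 * K) * f ^+ (r - n) * g ^+ n * x ^+ e) / f ^+ r.+2.
Proof.
move=> x0 f0 nr.
have -> : f ^+ r.+2 = f ^+ (r - n) * f ^+ n.+2 by rewrite -exprD addnS addnS subnK.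
rewrite !expr_div_n -![(x ^+ _) ^+ _]exprM.
have -> : x ^+ (K.+1 * n.+2) = x ^+ (K * n) * x ^+ (2 * K) * x ^+ n.+2.
  by rewrite -!exprD; congr (_ ^+ _); lia.
move: (expf_neq0 (K * n) x0) (expf_neq0 (2 * K) x0) (expf_neq0 n.+2 x0).
move: (expf_neq0 (r - n) f0) (expf_neq0 n.+2 f0).
move: (f ^+ (r - n)) (f ^+ n.+2) (x ^+ (K * n)) (x ^+ (2 * K)) (x ^+ n.+2) (g ^+ n) (x ^+ e).
by move=> a1 a2 a3 a4 a5 a6 a7 h1 h2 h3 h4 h5; field; rewrite ?h1 ?h2 ?h3 ?h4 ?h5.
Qed.

(** Since r > 0, a term with d_0 = 0, where the exponent of U_(k-1) is negative,
    has a zero binomial factor.  Otherwise the powers of x hidden in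
    U_(k-1) = f_(k-1) / x^(k-1) and U_k = f_k / x^k add up to x^(2k-2). *)
Lemma chebyshev_termE (R : realType) (r K b : nat) (d l : nat -> nat) :
  (0 < r)%N -> (d 0%N <= r)%N -> r = pattern_weight K.+1 b d l ->
  chebyshev_term R K.+1 b d l =
  tofrac ((\prod_(i < b.+1) ('C(d i + d i.+1 + l i - 1, d i.+1 + l i)
                            * 'C(d i.+1 + l i, l i)))%:R
    * (strip_coef 'X K r (d 0%N) * 'X^(\sum_(i < b.+1) (2 * d i + l i))))
  / tofrac (strip 'X K.+2 ^+ r.+2).
Proof.
move=> r0 + rE; rewrite /chebyshev_term; set e := (\sum_(i < b.+1) _)%N.
set C := (\prod_(i < b.+1) _)%N; case d0 : (d 0%N) => [|n] d0r.
  have [C0|C0] := eqVneq C 0%N; first by rewrite C0 !mulr0n !mul0r.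
  by move: r0; rewrite rE (pattern_weight_no_arc _ d0 C0).
rewrite subn1 -pred_Sn !evalfrac_chebyshev.
set x := fracX R; have x0 : x != 0 by apply: fracX_neq0.
have f0 : tofrac (strip ('X : {poly R}) K.+2) != 0.
  rewrite tofrac_eq0; apply/eqP => s0.
  by have := strip_coef0 R K.+1; rewrite s0 coef0 => /esym/eqP; rewrite oner_eq0.
have -> : n.+1%:Z - 1 = n by rewrite -addn1 PoszD addrK.
have -> : - 1 - n.+1%:Z + e%:Z = e%:Z - n.+2%:Z by rewrite -(addn1 n.+1) PoszD; ring.
rewrite (exprz_subn e n.+2 x0).
rewrite [(n.+1 + 1)%N]addn1.
rewrite -[_ ^ n%:Z]/(_ ^+ n).
rewrite (strip_term_ratio _ _ _ _ x0 f0 (ltnW d0r)).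
rewrite -[strip_coef _ _ _ _]/('X ^+ (2 * K) * strip 'X K.+2 ^+ (r - n) * strip 'X K.+1 ^+ n).
by rewrite [tofrac (_ ^+ r.+2)]tofracXn !tofracM !tofracXn rmorph_nat.
Qed.

(** * The expansion *)

Lemma pattern_weightE K b (d l : nat -> nat) :
  pattern_weight K.+1 b d l =
  (\sum_(i < b.+1) d i * ('C(2 * (K + i), 2 * K + 1) + 'C(2 * (K + i) + 1, 2 * K + 1))
   + \sum_(i < b.+1) l i * 'C(2 * (K.+1 + i), 2 * K + 1))%N.
Proof.
have e : (2 * K.+1 - 1 = 2 * K + 1)%N by lia.
rewrite /pattern_weight e; congr (_ + _)%N; apply: eq_bigr => i _.
  by congr (_ * ('C(_, _) + 'C(_, _)))%N; lia.
by congr (_ * 'C(_, _))%N; lia.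
Qed.

Theorem theorem4p2 (R : realType) (r k b : nat) (hr : (1 <= r)%N) (hk : (1 <= k)%N)
  (hrb : (r < minn 'C(2 * k + 2 * b + 2, 2 * k - 1)
                   ('C(2 * k + 2 * b, 2 * k - 1)
                    + 'C(2 * k + 2 * b + 1, 2 * k - 1)))%N) :
  is_expansion
    (fun n : nat =>
       #|[set s in I3412 n | #|occurrences (decreasing_pattern (2 * k)) s| == r]|%:R : R)
    (\sum_(d : {ffun 'I_b.+1 -> 'I_r.+1}) \sum_(l : {ffun 'I_b.+1 -> 'I_r.+1} |
         r == pattern_weight k b (extend0 d) (extend0 l))
       chebyshev_term R k b (extend0 d) (extend0 l)).
Proof.
case: k hk hrb => // K _; rewrite leq_min => /andP[_ hrb].
have rmu : (r < 'C(2 * (K.+1 + b), 2 * K + 1) + 'C(2 * (K.+1 + b) + 1, 2 * K + 1))%N.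
  by rewrite mulnDr (_ : 2 * K + 1 = 2 * K.+1 - 1)%N//; lia.
pose P (d l : {ffun 'I_b.+1 -> 'I_r.+1}) : {poly R} :=
  (\prod_(i < b.+1) ('C(extend0 d i + extend0 d i.+1 + extend0 l i - 1,
                        extend0 d i.+1 + extend0 l i)
                     * 'C(extend0 d i.+1 + extend0 l i, extend0 l i)))%:R
  * (strip_coef 'X K r (extend0 d 0)
     * 'X^(\sum_(i < b.+1) (2 * extend0 d i + extend0 l i))).
exists (\sum_(d : {ffun 'I_b.+1 -> 'I_r.+1}) \sum_(l : {ffun 'I_b.+1 -> 'I_r.+1} |
         r == pattern_weight K.+1 b (extend0 d) (extend0 l)) P d l),
  (strip 'X K.+2 ^+ r.+2); split.
- by rewrite -horner_coef0 horner_exp horner_coef0 strip_coef0 expr1n oner_eq0.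
- rewrite rmorph_sum mulr_suml; apply: eq_bigr => d _.
  rewrite rmorph_sum mulr_suml; apply: eq_bigr => l /eqP rE.
  apply: chebyshev_termE => //; rewrite /extend0; case: insubP => //= i _ _.
  by rewrite -ltnS.
move=> N; transitivity (\sum_(i < N.+1) (strip ('X : {poly R}) K.+2 ^+ r.+2)`_i *
    (weight_gf R (2 * K + 1) 0 (N - i))`_r).
  apply: eq_bigr => i _; congr (_ * _).
  by rewrite coef_weight_gf card_involutions_weight// mulnS add2n addn1.
rewrite (weight_gf_rational R N rmu); apply: (congr1 (fun p : {poly R} => p`_N)).
apply: eq_bigr => d _.
by apply: eq_bigl => l; rewrite pattern_weightE.
Qed.
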